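(* Let $G$ be a finite abelian group with $d(G)=2$ that has at least one cyclic Sylow subgroup, written as $G=S_{p_1}\times\cdots\times S_{p_j}\times\mathbb{Z}_s$, where $j\ge1$, $p_1,\dots,p_j$ are distinct primes, each $S_{p_i}$ is the Sylow $p_i$-subgroup and is non-cyclic, and $s>1$ is coprime to $p_1\cdots p_j$. Let $H=\bigotimes_{i=1}^{j}\Gamma(S_{p_i})$, let $\Delta(H)$ be the subgraph of $H$ induced by its non-isolated vertices, and let $\lambda_1,\lambda_2,\dots,\lambda_{|V(\Delta(H))|}$ be the eigenvalues, with multiplicity, of the adjacency matrix of $\Delta(H)$. Then $$S\bigl(L(\Delta(G))\bigr)=\bigcup_{i=1}^{|V(\Delta(H))|}S\bigl(d\,\widehat D-\lambda_i\widehat A\bigr),$$ where $d=r_1r_2\cdots r_j$ with $r_i$ the degree of the regular graph $\Delta(S_{p_i})$, $\widehat D$ is the vertex degree matrix of $\widehat\Gamma(\mathbb{Z}_s)$, and $\widehat A$ is the adjacency matrix of $\widehat\Gamma(\mathbb{Z}_s)$.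
   Context: The generating graph $\Gamma(G)$ of a group $G$ is the simple graph with vertex set $G$ in which two distinct vertices $x,y$ are adjacent if and only if $\langle x,y\rangle=G$; $\Delta(G)$ is the subgraph of $\Gamma(G)$ induced by its non-isolated vertices. For a non-cyclic abelian $p$-group $P$ with $d(P)=2$, the graph $\Delta(P)$ is regular (of degree $p\,\varphi(|P|/p)$, with $\varphi$ the Euler totient). $d(G)$ (distinct from the number $d$) is the minimum size of a generating set of $G$. The looped generating graph $\widehat\Gamma(\mathbb{Z}_s)$ is $\Gamma(\mathbb{Z}_s)$ with a loop added at each generator of $\mathbb{Z}_s$; a loop contributes $1$ to the degree of its vertex, and a diagonal entry $1$ in the adjacency matrix. The Kronecker product $\mathcal{G}_1\otimes\mathcal{G}_2$ of graphs has vertex set $V(\mathcal{G}_1)\times V(\mathcal{G}_2)$, with $(u_1,v_1)$ adjacent to $(u_2,v_2)$ if and only if $u_1u_2\in E(\mathcal{G}_1)$ and $v_1v_2\in E(\mathcal{G}_2)$. $L(\cdot)$ is the Laplacian matrix (degree matrix minus adjacency matrix). $S(M)$ denotes the multiset of eigenvalues of a matrix $M$, and the union is a union of multisets. *)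

(* Defs.v *)
From HB Require Import structures.
From mathcomp Require Import all_boot all_order all_algebra all_fingroup all_solvable.

Set Implicit Arguments.
Unset Strict Implicit.
Unset Printing Implicit Defensive.

Import GroupScope GRing.Theory.

(* Finite undirected graphs; loops are allowed, multiple edges are not. *)
Record graph := Graph {
  vertex :> finType;
  adj : rel vertex;
  adj_sym : symmetric adj }.

(* A loop at [v] contributes 1. *)
Definition degree (g : graph) (v : g) : nat := #|[set w | adj v w]|.

Definition regular (g : graph) (k : nat) : bool :=
  [forall v : g, degree v == k].

(* The [k] such that [g] is [k]-regular; the value is 0 if [g] is not regular. *)
Definition regular_degree (g : graph) : nat :=
  odflt ord0 [pick k : 'I_#|g|.+1 | regular g k].

Section Induced.
Variables (g : graph) (P : pred g).

Definition induced_adj : rel {v : g | P v} := fun u v => adj (val u) (val v).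

Fact induced_adj_sym : symmetric induced_adj.
Proof. by move=> u v; exact: adj_sym. Qed.

Definition induced : graph := Graph induced_adj_sym.
End Induced.

Definition nonisolated (g : graph) : graph :=
  @induced g (fun v => [exists w, adj v w]).

(* The Kronecker product of a finite family: vertices are the families of
   vertices of the factors, and adjacency is componentwise. *)
Section Kronecker.
Variables (I : finType) (g : I -> graph).

Definition kronecker_adj : rel {dffun forall i : I, g i} :=
  fun u v => [forall i, adj (u i) (v i)].

Fact kronecker_adj_sym : symmetric kronecker_adj.
Proof. by move=> u v; apply: eq_forallb => i; exact: adj_sym. Qed.

Definition kronecker : graph := Graph kronecker_adj_sym.
End Kronecker.

Section GeneratingGraph.
Variables (gT : finGroupType) (G : {group gT}).

Definition gen_adj : rel (subg_of G) :=
  fun x y => (x != y) && (<<[set sgval x; sgval y]>> == G :> {set gT}).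

Fact gen_adj_sym : symmetric gen_adj.
Proof. by move=> x y; rewrite /gen_adj eq_sym setUC. Qed.

Definition generating_graph : graph := Graph gen_adj_sym.

Definition Delta : graph := nonisolated generating_graph.

Definition looped_gen_adj : rel (subg_of G) :=
  fun x y => gen_adj x y || (x == y) && (<[sgval x]> == G :> {set gT}).

Fact looped_gen_adj_sym : symmetric looped_gen_adj.
Proof.
move=> x y; rewrite /looped_gen_adj gen_adj_sym; congr (_ || _).
by rewrite eq_sym; case: eqP => // ->.
Qed.

Definition looped_generating_graph : graph := Graph looped_gen_adj_sym.
End GeneratingGraph.

Section Matrices.
Local Open Scope ring_scope.
Variable C : numClosedFieldType.

Definition adjacency_mx (g : graph) : 'M[C]_#|g| :=
  \matrix_(i, j) (adj (enum_val i) (enum_val j))%:R.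

Definition degree_mx (g : graph) : 'M[C]_#|g| :=
  diag_mx (\row_i (degree (enum_val i))%:R).

Definition laplacian_mx (g : graph) : 'M[C]_#|g| :=
  degree_mx g - adjacency_mx g.

(* The eigenvalues with algebraic multiplicity; the order of the list carries
   no information, so multisets of eigenvalues are compared with [perm_eq]. *)
Definition spectrum n (M : 'M[C]_n) : seq C :=
  sval (closed_field_poly_normal (char_poly M)).
End Matrices.

Arguments adjacency_mx C g : clear implicits.
Arguments degree_mx C g : clear implicits.
Arguments laplacian_mx C g : clear implicits.

(* Main.v *)
Require Import Defs.
From HB Require Import structures.
From mathcomp Require Import all_boot all_order all_algebra all_fingroup all_solvable.

Set Implicit Arguments.
Unset Strict Implicit.
Unset Printing Implicit Defensive.

Import GroupScope GRing.Theory.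

(* The coprime components of a pair x, y are powers of x and y, so <x, y> = G
   iff every component pair generates its factor, where only in Z_s may the two
   components coincide. Hence Delta(G) is the Kronecker product of Delta(H) and
   the looped graph of Z_s, in which no vertex is isolated. Delta(H) is regular
   of degree d, so L(Delta(G)) = I (x) d Dhat - A (x) Ahat with A the adjacency
   matrix of Delta(H); A is real symmetric, and diagonalizing it leaves the
   blocks d Dhat - lambda_i Ahat. *)

(** * Characteristic polynomials and spectra of block and Kronecker matrices *)

Section LinearAlgebra.
Local Open Scope ring_scope.

(** Both products of characteristic matrices with [P] coincide; after taking determinants, [\det P]
    cancels because [R] is a domain. *)
Lemma char_poly_intertwine (R : idomainType) n (P A B : 'M[R]_n) :
  \det P != 0 -> P *m A = B *m P -> char_poly A = char_poly B.
Proof.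
move=> nzP PA; pose Q := map_mx polyC P.
have nzQ : \det Q != 0 by rewrite det_map_mx polyC_eq0.
apply: (mulfI nzQ); rewrite /char_poly -det_mulmx [RHS]mulrC -det_mulmx.
congr (\det _); rewrite /char_poly_mx mulmxBr mulmxBl -!map_mxM PA.
by rewrite mul_mx_scalar mul_scalar_mx.
Qed.

(** Reindexing is conjugation by a permutation matrix. In its use below, [m] and [n] are equal but
    not convertible. *)
Lemma char_poly_reindex (R : idomainType) m n (h : 'I_m -> 'I_n)
    (M : 'M[R]_n) (N : 'M[R]_m) :
  bijective h -> (forall i j, N i j = M (h i) (h j)) ->
  char_poly N = char_poly M.
Proof.
move=> bij_h NM.
have/eqP eq_mn : m == n by rewrite -[m]card_ord -[n]card_ord (bij_eq_card bij_h).
subst n; pose s := perm (bij_inj bij_h).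
apply: (@char_poly_intertwine _ _ (perm_mx s^-1)).
  by rewrite det_perm signr_eq0.
apply/matrixP=> i j; rewrite -row_permE -col_permE !mxE NM.
by congr (M _ _); rewrite -!(permE (bij_inj bij_h)) -/s ?permKV.
Qed.

Lemma char_poly_mxdiag (R : comNzRingType) n (p : 'I_n -> nat)
    (B : forall i, 'M[R]_(p i)) :
  char_poly (\mxdiag_i B i) = \prod_i char_poly (B i).
Proof.
(* The size [\sum_(i < 0) p i] of the empty block matrix is 0 only up to a proof. *)
have det0 k (M : 'M[{poly R}]_k) : k = 0%N -> \det M = 1.
  by move=> k0; subst k; rewrite det_mx00.
have cast k l (e : k = l) (M : 'M[R]_k) :
    char_poly (castmx (e, e) M) = char_poly M.
  by case: l / e; rewrite castmx_id.
elim: n p B => [|n IHn] p B; first by rewrite [RHS]big_ord0 [LHS]det0 ?big_ord0.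
rewrite [RHS]big_ord_recl -IHn mxdiag_recl cast /char_poly.
by rewrite char_block_diag_mx det_ublock.
Qed.

(** The block form, of size [\sum_(i < m) n] instead of [m * n], makes a diagonal left factor yield
    an [\mxdiag] directly. *)
Definition kronecker_mx (R : pzSemiRingType) m n (A : 'M[R]_m) (B : 'M[R]_n) :
    'M[R]_(\sum_(i < m) n) :=
  \mxblock_(i < m, j < m) (A i j *: B).

Lemma kronecker_mxM (R : comPzSemiRingType) m n (A A' : 'M[R]_m) (B B' : 'M[R]_n) :
  kronecker_mx A B *m kronecker_mx A' B' = kronecker_mx (A *m A') (B *m B').
Proof.
rewrite mul_mxblock; apply/eq_mxblock=> i k.
rewrite mxE scaler_suml; apply: eq_bigr => j _.
by rewrite -scalemxAl -scalemxAr scalerA.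
Qed.

Lemma kronecker_diag_mx (R : pzSemiRingType) m n (d : 'rV[R]_m) (B : 'M[R]_n) :
  kronecker_mx (diag_mx d) B = \mxdiag_(i < m) (d 0 i *: B).
Proof.
apply/eq_mxblock=> i j; rewrite mxE conform_mx_id.
by case: eqVneq => [->|]; rewrite ?mulr1n // mulr0n scale0r.
Qed.

Lemma kronecker_mx1 (R : pzSemiRingType) m n :
  kronecker_mx 1%:M 1%:M = 1%:M :> 'M[R]_(\sum_(i < m) n).
Proof.
rewrite -diag_const_mx kronecker_diag_mx -mxdiagZ.
by apply: eq_mxdiag => i; rewrite mxE scale1r.
Qed.

(** Conjugation by [kronecker_mx P 1%:M] fixes the first term and replaces [A] by [diag_mx sp] in
    the second, leaving a block diagonal matrix. *)
Lemma char_poly_kronecker (F : fieldType) m n (A P : 'M[F]_m) (sp : 'rV[F]_m)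
    (D B : 'M[F]_n) :
  P \in unitmx -> A = invmx P *m diag_mx sp *m P ->
  char_poly (kronecker_mx 1%:M D - kronecker_mx A B)
    = \prod_(i < m) char_poly (D - sp 0 i *: B).
Proof.
move=> uP defA.
transitivity (char_poly (kronecker_mx 1%:M D - kronecker_mx (diag_mx sp) B)).
  apply: (@char_poly_intertwine _ _ (kronecker_mx P 1%:M)).
    have /(congr1 determinant) : kronecker_mx P 1%:M *m
        kronecker_mx (invmx P) 1%:M = 1%:M :> 'M[F]_(\sum_(i < m) n).
      by rewrite kronecker_mxM mulmxV // mulmx1 kronecker_mx1.
    rewrite det_mulmx det1 => detP; apply/eqP=> detP0.
    by move/eqP: detP; rewrite detP0 mul0r eq_sym oner_eq0.
  rewrite mulmxBr mulmxBl !kronecker_mxM defA !mulmxA mulmxV //.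
  by rewrite !mulmx1 !mul1mx.
rewrite -diag_const_mx !kronecker_diag_mx -mxdiagB char_poly_mxdiag.
by apply: eq_bigr => i _; rewrite mxE scale1r.
Qed.

Lemma char_poly_spectrum (C : numClosedFieldType) n (M : 'M[C]_n) :
  char_poly M = \prod_(z <- spectrum M) ('X - z%:P).
Proof.
rewrite /spectrum; case: closed_field_poly_normal => r /= {1}->.
by rewrite (monicP (char_poly_monic M)) scale1r.
Qed.

(** The spectral theorem lists the eigenvalues in its own order [sp]. The product of the block
    polynomials depends only on their multiset, and [lam] and [sp] both enumerate [spectrum A]. *)
Lemma spectrum_kronecker (C : numClosedFieldType) m n (A : 'M[C]_m)
    (lam : 'I_m -> C) (D B : 'M[C]_n) :
  A \is normalmx -> perm_eq (codom lam) (spectrum A) ->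
  perm_eq (spectrum (kronecker_mx 1%:M D - kronecker_mx A B))
    (flatten [seq spectrum (D - lam i *: B) | i <- enum 'I_m]).
Proof.
move=> /orthomx_spectralP; set P := spectralmx A; set sp := spectral_diag A.
move=> defA lamA; apply: prod_XsubC_eq; rewrite -char_poly_spectrum.
have uP : P \in unitmx := spectral_unit A.
rewrite (char_poly_kronecker _ _ uP defA) big_flatten big_map.
under [RHS]eq_bigr do rewrite -char_poly_spectrum.
rewrite -(big_map lam predT (fun z => char_poly (D - z *: B))).
rewrite -[LHS](big_map (sp 0) predT (fun z => char_poly (D - z *: B))).
apply: perm_big; apply: (@perm_trans _ (spectrum A)); last first.
  by rewrite perm_sym -[map _ _]/(codom lam).
apply: prod_XsubC_eq; rewrite -char_poly_spectrum.
have -> : char_poly A = char_poly (diag_mx sp).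
  apply: (@char_poly_intertwine _ _ P); first by rewrite -unitfE -unitmxE.
  by rewrite {1}defA !mulmxA mulmxV // mul1mx.
rewrite char_poly_trig ?diag_mx_is_trig // big_map.
by apply: eq_big_seq => i _; rewrite mxE eqxx mulr1n.
Qed.

End LinearAlgebra.

(** * Degrees, regularity and isolated vertices *)

Section Graphs.

Definition nonisolated_vertex (g : graph) (v : g) (nv : [exists w, adj v w]) :
    nonisolated g :=
  @exist g (fun x => [exists w, adj x w]) v nv.

Lemma nonisolated_neighbor (g : graph) (v w : g) :
  adj v w -> [exists u, adj w u].
Proof. by move=> vw; apply/existsP; exists v; rewrite adj_sym. Qed.

(** A neighbour of any vertex is itself non-isolated, so no edge is lost. *)
Lemma degree_nonisolated (g : graph) (v : nonisolated g) :
  degree v = degree (val v).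
Proof.
rewrite /degree -(card_imset _ val_inj); congr #|pred_of_set _|.
apply/setP=> w; rewrite inE; apply/imsetP/idP => [[u]|vw].
  by rewrite inE => vu ->.
by exists (nonisolated_vertex (nonisolated_neighbor vw)); rewrite ?inE.
Qed.

Lemma degree_kronecker (I : finType) (g : I -> graph) (v : kronecker g) :
  degree v = (\prod_i degree ((v : {dffun _}) i))%N.
Proof.
rewrite /degree -(@cardsXn I g (fun i => [set w | adj (v i) w])).
congr #|pred_of_set _|; apply/setP=> w; rewrite in_setXn inE.
by apply: eq_forallb => i; rewrite inE.
Qed.

(** The vertex [v] excludes the empty graph, which is regular of every degree; the search range
    suffices since a degree is at most [#|g|]. *)
Lemma regular_degreeE (g : graph) k (v : g) :
  regular g k -> degree v = regular_degree g.
Proof.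
move=> /forallP reg_k; rewrite /regular_degree; case: pickP => [k' /forallP/(_ v)/eqP //|].
have lt_k : (k < #|g|.+1)%N by rewrite ltnS -(eqP (reg_k v)) max_card.
by move=> /(_ (Ordinal lt_k)) /negP[]; apply/forallP.
Qed.

(** A neighbour in the product gives a neighbour of each component, so every component lies in its
    regular factor, and degrees multiply. *)
Lemma regular_nonisolated_kronecker (I : finType) (g : I -> graph) (k : I -> nat) :
  (forall i, regular (nonisolated (g i)) (k i)) ->
  regular (nonisolated (kronecker g))
    (\prod_i regular_degree (nonisolated (g i)))%N.
Proof.
move=> reg; apply/forallP=> v; apply/eqP.
rewrite degree_nonisolated degree_kronecker; apply: eq_bigr => i _.
have v_i : [exists w, adj ((val v : {dffun _}) i) w].
  have /existsP[w /forallP/(_ i) vw] := valP v.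
  by apply/existsP; exists ((w : {dffun _}) i).
pose u : nonisolated (g i) := nonisolated_vertex v_i.
by rewrite -(regular_degreeE u (reg i)) degree_nonisolated.
Qed.

(** * Graphs isomorphic to a Kronecker product of two factors *)

Section Product.
Variables (g h w : graph) (f : h * w -> g).
Hypothesis bij_f : bijective f.
Hypothesis adj_f : forall x y, adj (f x) (f y) = adj x.1 y.1 && adj x.2 y.2.

Lemma degree_product x : degree (f x) = (degree x.1 * degree x.2)%N.
Proof.
rewrite /degree -cardsX -(card_imset _ (bij_inj bij_f)).
congr #|pred_of_set _|; apply/setP=> y; case: bij_f => f' fK f'K.
rewrite -[y]f'K mem_imset; last exact: can_inj fK.
by case: (f' y) => a b; rewrite in_setX !inE adj_f.
Qed.

(** As every vertex of [w] has a neighbour, [f (u, z)] is isolated exactly when [u] is. *)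
Lemma nonisolated_product :
  (forall z : w, [exists z', adj z z']) ->
  exists2 f' : nonisolated h * w -> nonisolated g, bijective f' &
    forall x y, adj (f' x) (f' y) = adj x.1 y.1 && adj x.2 y.2.
Proof.
move=> w_full; case: bij_f => f1 fK f1K.
have noniso u z : [exists v, adj (f (u, z)) v] = [exists v, adj u v].
  apply/existsP/existsP=> [[v]|[v uv]].
    by rewrite -[v]f1K adj_f => /andP[uv _]; exists (f1 v).1.
  have /existsP[z' zz'] := w_full z.
  by exists (f (v, z')); rewrite adj_f uv.
have f_nonisolated (x : nonisolated h * w) :
    [exists v, adj (f (val x.1, x.2)) v] by rewrite noniso (valP x.1).
have f1_nonisolated (y : nonisolated g) : [exists v, adj (f1 (val y)).1 v].
  by rewrite -(noniso _ (f1 (val y)).2) -surjective_pairing f1K (valP y).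
exists (fun x => nonisolated_vertex (f_nonisolated x)) => [|x y]; last exact: adj_f.
exists (fun y => (nonisolated_vertex (f1_nonisolated y), (f1 (val y)).2)) => [[x z]|y].
  by congr (_, _); [apply: val_inj|]; rewrite /= fK.
by apply: val_inj; rewrite /= -surjective_pairing f1K.
Qed.

(** Regularity of [h] makes the degree matrix of [g] a Kronecker product as well, with left factor
    the identity. *)
Lemma spectrum_laplacian_product (C : numClosedFieldType) k (lam : 'I_#|h| -> C) :
  regular h k -> perm_eq (codom lam) (spectrum (adjacency_mx C h)) ->
  perm_eq (spectrum (laplacian_mx C g))
    (flatten [seq spectrum (k%:R *: degree_mx C w - lam i *: adjacency_mx C w)%R
             | i <- enum 'I_#|h|]).
Proof.
move=> /forallP reg_k lamP; set D := (_ *: degree_mx C w)%R.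
have normA : adjacency_mx C h \is normalmx.
  apply: symmetric_normalmx.
    apply/is_hermitianmxP; rewrite expr0 scale1r map_mx_id //.
    by apply/matrixP=> i j; rewrite !mxE adj_sym.
  by apply/mxOverP=> i j; rewrite mxE Num.Theory.realn.
apply: (perm_trans _ (spectrum_kronecker D (adjacency_mx C w) normA lamP)).
apply: prod_XsubC_eq; rewrite -!char_poly_spectrum; apply/esym.
(* [e] decodes a row index: the block number gives the vertex of [h], the position inside the block
   that of [w]. *)
pose e (i : 'I_(\sum_(i < #|h|) #|w|)) :=
  (enum_val (tagnat.sig1 i) : h, enum_val (tagnat.sig2 i) : w).
have bij_e : bijective e.
  exists (fun x => tagnat.Rank (enum_rank x.1) (enum_rank x.2)) => [i|[x z]].
    by rewrite /= !enum_valK tagnat.sig2K.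
  rewrite /e tagnat.Rank1K tagnat.Rank2K enum_rankK; congr (_, _).
  by rewrite -[RHS]enum_rankK; congr enum_val; apply: val_inj.
apply: (@char_poly_reindex _ _ _ (fun i => enum_rank (f (e i)))).
  by apply: bij_comp (bij_comp bij_f bij_e); apply: enum_rank_bij.
move=> i j; rewrite !mxE !enum_rankK degree_product (eqP (reg_k _)) adj_f.
rewrite (inj_eq enum_rank_inj) (inj_eq (bij_inj bij_f)) xpair_eqE.
rewrite !(inj_eq enum_val_inj) natrM.
case: (tagnat.sig1 i == _); case: (adj (enum_val (tagnat.sig1 i)) _) => /=;
  by rewrite ?mul1r ?mul0r ?mulrnAr.
Qed.

End Product.
End Graphs.

(** * Generating pairs in abelian groups *)

Section GeneratingPairs.
Variable gT : finGroupType.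
Implicit Types G P S Z : {group gT}.

(** A generating pair of a non-cyclic group has distinct entries, since one element generates a
    cyclic group. *)
Lemma gen_adjE G x y : ~~ cyclic G ->
  @gen_adj gT G x y = (<<[set sgval x; sgval y]>> == G).
Proof.
move=> ncG; rewrite /gen_adj; case: eqVneq => //= <-.
rewrite setUid; apply/esym/negbTE; apply: contra ncG => /eqP <-.
exact: cycle_cyclic.
Qed.

(** The loops supply exactly the generating pairs with equal entries. *)
Lemma looped_gen_adjE G x y :
  @looped_gen_adj gT G x y = (<<[set sgval x; sgval y]>> == G).
Proof.
rewrite /looped_gen_adj /gen_adj; case: eqVneq => [<-|_] /=.
  by rewrite setUid.
by rewrite orbF.
Qed.

(* The quotient of [P] by <x> is cyclic, so only one maximal subgroup of [P]
   contains x, and the neighbours of x are the elements outside it. *)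
Lemma card_generating_mates (p : nat) P x y0 :
  p.-group P -> abelian P -> ~~ cyclic P -> <<[set x; y0]>> = P ->
  #|[set y in P | <<[set x; y]>> == P]| = (#|P| - #|P| %/ p)%N.
Proof.
move=> pP cPP ncP genP.
have [Px Py0] : x \in P /\ y0 \in P.
  by rewrite -genP !mem_gen ?inE ?eqxx ?orbT.
have sXP : <[x]> \subset P by rewrite cycle_subG.
have nXP (A : {set gT}) : A \subset P -> A \subset 'N(<[x]>).
  by move=> sAP; apply: subset_trans sAP (sub_abelian_norm cPP sXP).
have cycPX : cyclic (P / <[x]>).
  have -> : P :=: <[y0]> <*> <[x]>.
    by rewrite joing_idl joing_idr joingE setUC genP.
  by rewrite quotientYidr ?nXP ?cycle_subG // quotient_cyclic ?cycle_cyclic.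
have [defP|[M maxM sXM]] := maximal_exists sXP.
  by case/negP: ncP; rewrite -defP cycle_cyclic.
have [sMP _] := andP (maxgroupp maxM).
(* Both maximal subgroups have index [p], and the cyclic group [P / <[x]>] has only one subgroup of
   each order. *)
have uniqM (N : {group gT}) : maximal N P -> <[x]> \subset N -> N = M.
  move=> maxN sXN; have [sNP _] := andP (maxgroupp maxN).
  apply/val_inj/(@quotient_inj _ <[x]>%G); rewrite /= ?inE.
  - by rewrite /normal sXN nXP.
  - by rewrite /normal sXM nXP.
  apply/eqP; rewrite (eq_subG_cyclic cycPX) ?quotientS //.
  rewrite !card_quotient ?nXP //.
  rewrite -(divgS sXN) -(divgS sXM) -(divg_indexS sNP) -(divg_indexS sMP).
  by rewrite !(p_maximal_index pP).
have -> : [set y in P | <<[set x; y]>> == P] = P :\: M.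
  apply/setP=> y; rewrite !inE andbC; case Py: (y \in P); rewrite ?andbF //= !andbT.
  apply/eqP/idP => [genxy|notMy].
    have [_] := andP (maxgroupp maxM); apply: contra => My.
    by rewrite -genxy gen_subG subUset !sub1set My andbT -cycle_subG.
  have sxyP : <<[set x; y]>> \subset P by rewrite gen_subG subUset !sub1set Px.
  have [//|[N maxN]] := maximal_exists sxyP.
  rewrite gen_subG subUset !sub1set => /andP[Nx Ny].
  by case/negP: notMy; rewrite -(uniqM N) // cycle_subG.
rewrite cardsD (setIidPr sMP); congr (_ - _)%N.
by rewrite -(p_maximal_index pP maxM) -(Lagrange sMP) mulnK.
Qed.

(** A non-isolated vertex has a mate, so the count of its mates applies; for non-cyclic [P] it
    equals p φ(|P|/p). *)
Lemma regular_Delta (p : nat) P : p.-group P -> abelian P -> ~~ cyclic P ->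
  regular (Delta P) (#|P| - #|P| %/ p)%N.
Proof.
move=> pP cPP ncP; apply/forallP=> v; rewrite degree_nonisolated.
have /existsP[w] := valP v; rewrite [adj _ _]gen_adjE // => /eqP genP.
rewrite -(card_generating_mates pP cPP ncP genP) /degree.
rewrite -(card_imset _ val_inj); apply/eqP; congr #|pred_of_set _|.
apply/setP=> y; rewrite inE; apply/imsetP/andP => [[z] + ->|[Py gy]].
  by rewrite inE [adj _ _]gen_adjE // (valP z).
exists (subg P y); last by rewrite /= subgK.
by rewrite inE [adj _ _]gen_adjE //= subgK.
Qed.

Lemma constt_prod (I : finType) G (a : I -> gT) pi : abelian G ->
  (forall i, a i \in G) -> (\prod_i a i).`_pi = \prod_i (a i).`_pi.
Proof.
(* Membership in [G] is carried through the induction to provide the commutation that [consttM] asks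
   for. *)
move=> cGG Ga; suff [] : \prod_i a i \in G /\
  (\prod_i a i).`_pi = \prod_i (a i).`_pi by [].
pose R x y := x \in G /\ x.`_pi = y; apply: (big_ind2 R).
- by rewrite /R group1 constt1.
- move=> x1 y1 x2 y2 [Gx1 <-] [Gx2 <-]; split; first exact: groupM.
  by rewrite consttM //; apply: (centsP cGG).
- by move=> i _.
Qed.

(** On an abelian group, taking the [pi]-constituent is a morphism that maps into [H] and fixes [H]
    pointwise, so it sends generators of [G] to generators of [H]. *)
Lemma gen_constt pi G (H : {group gT}) x y : abelian G -> pi.-Hall(G) H ->
  <<[set x; y]>> = G -> <<[set x.`_pi; y.`_pi]>> = H.
Proof.
move=> cGG hallH genG.
have [Gx Gy] : x \in G /\ y \in G.
  by rewrite -genG !mem_gen ?inE ?eqxx ?orbT.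
have nHG : H <| G.
  by rewrite -sub_abelian_normal // (pHall_sub hallH).
have mem_H z : z \in G -> z.`_pi \in H.
  by move=> Gz; rewrite (mem_normal_Hall hallH nHG) ?p_elt_constt ?groupX.
have consttGM : {in G &, {morph (fun z => z.`_pi) : u v / u * v}}.
  by move=> u v Gu Gv; apply: consttM; apply: (centsP cGG).
pose f := Morphism consttGM.
apply/eqP; rewrite eqEsubset gen_subG subUset !sub1set !mem_H //=.
apply/subsetP=> h Hh; have Gh := subsetP (pHall_sub hallH) h Hh.
have : f h \in f @* G by apply: mem_morphim.
have sxyG : [set x; y] \subset G by rewrite subUset !sub1set Gx.
have := morphim_gen f sxyG; rewrite genG => ->.
rewrite morphimU !morphim_set1 //= constt_p_elt //.
exact: mem_p_elt (pHall_pgroup hallH) Hh.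
Qed.

End GeneratingPairs.

(** * Factorization of the generating graph along Hall subgroups *)

(** [F] multiplies the components together, and constituents recover them. [W] stands for a copy of
    [Z] in another group type. *)
Lemma generating_graph_product (gT rT : finGroupType) (W : {group rT}) (I : finType)
    (p : I -> nat) (pi : nat_pred) (G : {group gT}) (S : I -> {group gT}) (Z : {group gT})
    (i0 : I) :
  abelian G -> injective p -> (forall i, (p i).-Sylow(G) (S i)) ->
  (forall i, ~~ cyclic (S i)) -> (forall i, p i \notin pi) ->
  pi.-Hall(G) Z -> W \isog Z -> (\big[dprod/1]_i S i) \x Z = G ->
  exists2 F : kronecker (fun i => generating_graph (S i)) *
              looped_generating_graph W -> generating_graph G,
    bijective F &
    forall x y, adj (F x) (F y) = adj x.1 y.1 && adj x.2 y.2.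
Proof.
move=> cGG p_inj sylS ncS p_pi hallZ /isogP[f injf imf] defG.
have sSG i : S i \subset G := pHall_sub (sylS i).
have sZG : Z \subset G := pHall_sub hallZ.
(* The index [i0] provides one non-cyclic subgroup of [G]. *)
have ncG : ~~ cyclic G by apply: contra (ncS i0); apply: cyclicS.
pose U := {dffun forall i, subg_of (S i)}.
pose prodU (u : U) := \prod_i sgval (u i).
have GSu (u : U) i : sgval (u i) \in G by rewrite (subsetP (sSG i)) ?subgP.
have GU u : prodU u \in G by apply: group_prod => i _; exact: GSu.
have Zf (w : subg_of W) : f (sgval w) \in Z by rewrite -imf mem_morphim ?subgP.
have Gf w : f (sgval w) \in G := subsetP sZG _ (Zf w).
pose F0 (x : U * subg_of W) := prodU x.1 * f (sgval x.2).
have GF0 x : F0 x \in G by rewrite groupM.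
have F0M pi' x : (F0 x).`_pi' = (prodU x.1).`_pi' * (f (sgval x.2)).`_pi'.
  by rewrite consttM //; apply: (centsP cGG).
(* The other [S k] consist of [p k]-elements and [Z] of [pi]-elements with [p i \notin pi], so their
   [p i]-constituents are trivial. *)
have F0p i x : (F0 x).`_(p i) = sgval (x.1 i).
  rewrite F0M (constt_prod _ cGG) => [|k]; last exact: GSu.
  rewrite (big_only1 i) // => [|k ki _].
    rewrite constt_p_elt ?(mem_p_elt (pHall_pgroup (sylS i)) (subgP _)) //.
    have /constt1P-> : (p i)^'.-elt (f (sgval x.2)).
      apply: sub_p_elt (mem_p_elt (pHall_pgroup hallZ) (Zf _)).
      by move=> q pi_q; rewrite !inE; apply: contraNneq (p_pi i) => <-.
    by rewrite mulg1.
  apply/constt1P; apply: sub_p_elt (mem_p_elt (pHall_pgroup (sylS k)) (subgP _)).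
  by move=> q; rewrite !inE => /eqP->; rewrite (inj_eq p_inj).
have F0pi x : (F0 x).`_pi = f (sgval x.2).
  rewrite F0M (constt_prod _ cGG) => [|k]; last exact: GSu.
  rewrite big1 => [|k _].
    by rewrite mul1g constt_p_elt // (mem_p_elt (pHall_pgroup hallZ)).
  apply/constt1P; apply: sub_p_elt (mem_p_elt (pHall_pgroup (sylS k)) (subgP _)).
  by move=> q; rewrite !inE => /eqP->.
exists (fun x => subg G (F0 x)) => [|x y].
  (* Constituents give injectivity; the orders of the factors multiply to [#|G|], which gives
     surjectivity. *)
  apply: inj_card_bij => [x y /(congr1 (@sgval _ G))|].
    rewrite !subgK // => eqF; case: x y eqF => [u w] [v z] eqF; congr (_, _).
      apply/ffunP=> i; apply: subg_inj.
      by rewrite -(F0p i (u, w)) eqF F0p.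
    apply: subg_inj; apply: (injmP injf); rewrite ?subgP //.
    by rewrite -(F0pi (u, w)) eqF F0pi.
  rewrite card_prod card_dep_ffun foldrE big_map big_enum /=.
  have card_subg_of (aT : finGroupType) (A : {group aT}) : #|{: subg_of A}| = #|A|.
    by rewrite (card_isog (isog_subg A)) cardsT.
  rewrite !card_subg_of -(dprod_card defG) -imf card_injm //.
  have [[H _ defH _] _ _ _] := dprodP defG.
  rewrite defH -(bigdprod_card defH); apply/eq_leq; congr (_ * _)%N.
  by apply: eq_bigr => i _; rewrite card_subg_of.
rewrite [LHS]gen_adjE // !subgK // [X in _ && X]looped_gen_adjE.
have morW : <<[set sgval x.2; sgval y.2]>> == W =
    (<<[set f (sgval x.2); f (sgval y.2)]>> == Z).
  have sW : [set sgval x.2; sgval y.2] \subset W.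
    by rewrite subUset !sub1set !subgP.
  have sgW : <<[set sgval x.2; sgval y.2]>> \subset W by rewrite gen_subG.
  rewrite !eqEsubset -imf -(injmSK injf) // -(injmSK injf) ?subxx //.
  by rewrite morphim_gen // morphimU !morphim_set1 ?subgP.
rewrite morW; apply/eqP/andP=> [genG|[/forallP genS /eqP genZ]].
  split.
    apply/forallP=> i; rewrite [adj _ _]gen_adjE // -!F0p.
    by rewrite (gen_constt cGG (sylS i) genG).
  by rewrite -!F0pi (gen_constt cGG hallZ genG).
set K := <<_>>.
(* Constituents are powers, so [K] contains generators of every [S i] and of [Z], whose product is
   [G]. *)
have sK q : <<[set (F0 x).`_q; (F0 y).`_q]>> \subset K.
  by rewrite gen_subG subUset !sub1set !groupX // mem_gen // !inE eqxx ?orbT.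
apply/eqP; rewrite eqEsubset gen_subG subUset !sub1set !GF0 /=.
rewrite -(dprodW defG) mul_subG //; last by rewrite -genZ -!F0pi sK.
have [[H _ defH _] _ _ _] := dprodP defG.
rewrite defH -(bigdprodW defH); apply/subsetP=> _ /prodsgP[c Sc ->].
apply: group_prod => i _; apply: subsetP (Sc i isT).
have := genS i; rewrite [adj _ _]gen_adjE // => /eqP <-.
by rewrite -!F0p sK.
Qed.

(** * Application to the Sylow factors and the cyclic factor of [G] *)

Theorem theorem6p7 (C : numClosedFieldType) (gT : finGroupType)
  (G : {group gT}) (hGab : abelian G) (hGrank : 'm(G) = 2%N)
  (j : nat) (hj : (1 <= j)%N)
  (p : 'I_j -> nat) (hp : forall i, prime (p i)) (hpinj : injective p)
  (S : 'I_j -> {group gT})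
  (hSyl : forall i, (p i).-Sylow(G) (S i))
  (hSnc : forall i, ~~ cyclic (S i))
  (s : nat) (hs : (1 < s)%N) (hsp : coprime s (\prod_(i < j) p i)%N)
  (Z : {group gT}) (hZ : Z \isog Zp s)
  (hG : (\big[dprod/1]_(i < j) S i) \x Z = G) :
  let H := kronecker (fun i => generating_graph (S i)) in
  let d := (\prod_(i < j) regular_degree (Delta (S i)))%N in
  let Dhat := degree_mx C (looped_generating_graph (Zp_group s)) in
  let Ahat := adjacency_mx C (looped_generating_graph (Zp_group s)) in
  forall lam : 'I_#|nonisolated H| -> C,
  perm_eq (codom lam) (spectrum (adjacency_mx C (nonisolated H))) ->
  perm_eq (spectrum (laplacian_mx C (Delta G)))
    (flatten [seq spectrum (d%:R *: Dhat - lam i *: Ahat)%R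
             | i <- enum 'I_#|nonisolated H|]).
Proof.
move=> H d Dhat Ahat lam lamP.
have s_gt0 : (0 < s)%N := ltnW hs.
have cardZ : #|Z| = s by rewrite (card_isog hZ) card_Zp.
have p_s i : p i \notin \pi(s).
  rewrite mem_primes hp s_gt0 /=; apply/negP=> p_dvd_s; move: hsp.
  by rewrite (bigD1 i) //= coprimeMr coprime_sym prime_coprime ?p_dvd_s.
(* The index of [Z] is the product of the orders [#|S i|], whose primes [p i] lie outside
   [\pi(s)]. *)
have hallZ : \pi(s).-Hall(G) Z.
  have sZG : Z \subset G by have [_ /normal_sub] := dprod_normal2 hG.
  rewrite /pHall sZG /pgroup cardZ pnat_pi //= -divgS //.
  have [[K _ defK _] _ _ _] := dprodP hG.
  rewrite -(dprod_card hG) mulnK ?cardG_gt0 // defK -(bigdprod_card defK).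
  apply: (big_ind (pnat \pi(s)^')) => // [m n|i _]; first by rewrite pnatM => ->.
  apply: sub_in_pnat (pHall_pgroup (hSyl i)) => q _.
  by rewrite !inE => /eqP->.
have isoZ : Zp_group s \isog Z by rewrite isog_sym.
have [F bijF adjF] := generating_graph_product (Ordinal hj) hGab hpinj hSyl
  hSnc p_s hallZ isoZ hG.
(* The generator [Zp1] is adjacent to every vertex, and to itself through its loop; [hs] is what
   makes [Zp s] the full cyclic group. *)
have W_full (z : looped_generating_graph (Zp_group s)) : [exists z', adj z z'].
  have defW : Zp s = <[Zp1]> by rewrite /Zp hs Zp_cycle.
  have W1 : Zp1 \in Zp_group s by rewrite /= defW cycle_id.
  apply/existsP; exists (subg (Zp_group s) Zp1).
  rewrite [adj _ _]looped_gen_adjE subgK // eqEsubset gen_subG subUset !sub1set.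
  by rewrite subgP W1 /= {1}defW cycle_subG mem_gen // !inE eqxx orbT.
have [f bijf adjf] := nonisolated_product bijF adjF W_full.
apply: (spectrum_laplacian_product bijf adjf _ lamP).
apply: regular_nonisolated_kronecker => i.
apply: regular_Delta (pHall_pgroup (hSyl i)) _ (hSnc i).
exact: abelianS (pHall_sub (hSyl i)) hGab.
Qed.
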